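(* Let $X$ be a non-empty $n$-element set. Let $\hat 0_l\in\Pi_l(X)$ be the labelled set partition into $n$ unlabelled singletons, $\sigma_n\in\Pi_l(X)$ the labelled set partition into $n$ labelled singletons $\{x,l\}$, and $\hat 1_l=\{X\cup\{l\}\}$. Then \[ \mu_{\Pi_l(X)}(\sigma_n,\hat 1_l)=(-1)^{n-1}(n-1)!,\qquad \mu_{\Pi_l(X)}(\hat 0_l,\hat 1_l)=(-1)^n(n-1)!. \]
   Context: For a finite set $X$ and a symbol $l\notin X$, a labelled set partition of $X$ is a collection $\pi=\{B_1\cup L_1,\dots,B_k\cup L_k\}$ where $\{B_1,\dots,B_k\}$ is a set partition of $X$ and each $L_i\in\{\emptyset,\{l\}\}$ (labelled block if $L_i=\{l\}$, unlabelled otherwise). $\Pi_l(X)$ is the set of all such, partially ordered by $\sigma\le\pi$ iff every block of $\sigma$ (as a set, including $l$ if present) is contained in some block of $\pi$. $\mu_{\Pi_l(X)}$ is its Möbius function: $\mu(x,x)=1$, $\sum_{x\le z\le y}\mu(x,z)=0$ for $x<y$, $\mu(x,y)=0$ if $x\not\le y$. *)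

(* Defs.v *)
From HB Require Import structures.
From mathcomp Require Import all_boot all_order all_algebra.

Set Implicit Arguments.
Unset Strict Implicit.
Unset Printing Implicit Defensive.

Import Order.TTheory GRing.Theory.

Local Open Scope ring_scope.

Section Mobius.
Local Open Scope order_scope.
Variables (d : Order.disp_t) (T : finPOrderType d).
Implicit Types x y z : T.

(* Recursion on fuel: each call strictly decreases y, so #|T| steps suffice
   and the value does not depend on the fuel (see mobius_sum). *)
Fixpoint mobius_rec (k : nat) (x y : T) : int :=
  if k is k'.+1 then
    if x == y then 1%R
    else if x < y then (- \sum_(z : T | (x <= z < y)%O) mobius_rec k' x z)%R
    else 0%R
  else 0%R.

Definition mobius (x y : T) : int := mobius_rec #|T| x y.

Let down y := [set z : T | z <= y].

Lemma card_down_gt0 y : (0 < #|down y|)%N.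
Proof. by apply/card_gt0P; exists y; rewrite inE. Qed.

Lemma card_down_lt z y : z < y -> (#|down z| < #|down y|)%N.
Proof.
move=> zy; apply/proper_card/properP; split.
  by apply/subsetP => w; rewrite !inE => /le_trans; apply; exact: ltW.
by exists y; rewrite !inE // lt_geF.
Qed.

Lemma mobius_rec_fuel j k x y :
  (#|down y| <= j)%N -> (#|down y| <= k)%N ->
  mobius_rec j x y = mobius_rec k x y.
Proof.
elim: j k y => [|j IH] [|k] y //.
- by rewrite leqn0 eqn0Ngt card_down_gt0.
- by move=> _; rewrite leqn0 eqn0Ngt card_down_gt0.
move=> hj hk /=; case: eqP => // _; case: ifP => // _; congr (- _)%R.
apply: eq_bigr => z /andP[_ zy].
by apply: IH; rewrite -ltnS; apply: leq_trans (card_down_lt zy) _.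
Qed.

Lemma mobiusE x y :
  mobius x y =
    if x == y then 1%R
    else if x < y then (- \sum_(z : T | (x <= z < y)%O) mobius x z)%R
    else 0%R.
Proof.
rewrite /mobius (@mobius_rec_fuel _ #|T|.+1) //=; first exact: max_card.
by apply: leqW; exact: max_card.
Qed.

Lemma mobius_refl x : mobius x x = 1%R.
Proof. by rewrite mobiusE eqxx. Qed.

Lemma mobius_sum x y :
  x < y -> (\sum_(z : T | (x <= z <= y)%O) mobius x z = 0)%R.
Proof.
move=> xy; rewrite (bigD1 y) /=; last by rewrite lexx (ltW xy).
rewrite (mobiusE x y) (lt_eqF xy) xy addrC.
rewrite (eq_bigl (fun z => x <= z < y)) ?subrr // => z.
by rewrite lt_neqAle -andbA [(_ <= y) && _]andbC.
Qed.

Lemma mobius_nle x y : ~~ (x <= y) -> mobius x y = 0%R.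
Proof.
move=> nxy; rewrite mobiusE; case: eqP => [exy|_].
  by rewrite exy lexx in nxy.
by case: ifP => // /ltW; rewrite (negPf nxy).
Qed.

End Mobius.

Section LabelledPartitions.
Variable X : finType.

(* X + {l} is option X: l is None, and x : X is Some x.  A labelled block is
   one that belongs to L. *)
Definition lblock (L : {set {set X}}) (B : {set X}) : {set option X} :=
  (Some @: B) :|: (if B \in L then [set None] else set0).

Definition is_lpart (pi : {set {set option X}}) : bool :=
  [exists P : {set {set X}}, exists L : {set {set X}},
     partition P [set: X] && (pi == [set lblock L B | B in P])].

Record lpart : Type :=
  LPart { lpart_blocks :> {set {set option X}}; _ : is_lpart lpart_blocks }.

HB.instance Definition _ := [isSub for lpart_blocks].
HB.instance Definition _ := [Finite of lpart by <:].

Definition lpart_le (sigma pi : lpart) : bool :=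
  [forall B in lpart_blocks sigma, [exists C in lpart_blocks pi, B \subset C]].

Lemma lblock_Some L B x : (Some x \in lblock L B) = (x \in B).
Proof.
rewrite inE mem_imset; last exact: Some_inj.
by case: (B \in L); rewrite !inE orbF.
Qed.

Lemma lpart_sub_eq (pi : lpart) (B C : {set option X}) :
  B \in lpart_blocks pi -> C \in lpart_blocks pi -> B \subset C -> B = C.
Proof.
case: pi => pi /= /existsP[P /existsP[L /andP[/and3P[_ tP nP] /eqP->]]].
move=> /imsetP[B' PB ->] /imsetP[C' PC ->] /subsetP sBC.
have /set0Pn[x xB]: B' != set0 by apply: contraNneq nP => <-.
have xC : x \in C' by rewrite -(lblock_Some L) sBC ?lblock_Some.
by rewrite -(def_pblock tP PB xB) (def_pblock tP PC xC).
Qed.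

Lemma lpart_le_refl : reflexive lpart_le.
Proof.
by move=> pi; apply/forall_inP => B hB; apply/exists_inP; exists B.
Qed.

Lemma lpart_le_trans : transitive lpart_le.
Proof.
move=> pi sigma tau /forall_inP h1 /forall_inP h2.
apply/forall_inP => B /h1/exists_inP[C /h2/exists_inP[D hD CD] BC].
by apply/exists_inP; exists D => //; exact: subset_trans CD.
Qed.

Lemma lpart_le_sub (sigma pi : lpart) :
  lpart_le sigma pi -> lpart_le pi sigma ->
  lpart_blocks sigma \subset lpart_blocks pi.
Proof.
move=> /forall_inP h1 /forall_inP h2; apply/subsetP => B hB.
have /exists_inP[C hC BC] := h1 _ hB.
have /exists_inP[D hD CD] := h2 _ hC.
have eBD := lpart_sub_eq hB hD (subset_trans BC CD).
suff -> : B = C by [].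
by apply/eqP; rewrite eqEsubset BC eBD CD.
Qed.

Lemma lpart_le_anti : antisymmetric lpart_le.
Proof.
move=> sigma pi /andP[h1 h2]; apply: val_inj; apply/eqP.
by rewrite eqEsubset /= !lpart_le_sub.
Qed.

Fact lpart_display : Order.disp_t. Proof. exact: Order.Disp tt tt. Qed.

HB.instance Definition _ := Order.Le_isPOrder.Build lpart_display lpart
  lpart_le_refl lpart_le_anti lpart_le_trans.

Lemma partition_singletons : partition [set [set x] | x : X] [set: X].
Proof.
apply/and3P; split.
- apply/eqP/setP => x; rewrite inE; apply/bigcupP; exists [set x].
    exact: imset_f.
  exact: set11.
- apply/trivIsetP => _ _ /imsetP[x _ ->] /imsetP[y _ ->] nxy.
  by rewrite disjoints1 inE; apply: contraNneq nxy => ->.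
- apply/imsetP => -[x _ /setP/(_ x)]; by rewrite !inE eqxx.
Qed.

Lemma lpart_bot_subproof : is_lpart [set [set Some x] | x : X].
Proof.
apply/existsP; exists [set [set x] | x : X]; apply/existsP; exists set0.
rewrite partition_singletons -imset_comp; apply/eqP/eq_imset => x /=.
by rewrite /lblock inE imset_set1 setU0.
Qed.

Definition lpart_bot : lpart := LPart lpart_bot_subproof.

Lemma lpart_sing_subproof : is_lpart [set [set Some x; None] | x : X].
Proof.
apply/existsP; exists [set [set x] | x : X]; apply/existsP; exists setT.
rewrite partition_singletons -imset_comp; apply/eqP/eq_imset => x /=.
by rewrite /lblock inE imset_set1.
Qed.

Definition lpart_sing : lpart := LPart lpart_sing_subproof.

(* {X + {l}} is a labelled partition only if X is non-empty: with X empty,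
   it would need an empty block in the underlying partition. *)
Lemma lpart_top_subproof : (0 < #|X|)%N -> is_lpart [set [set: option X]].
Proof.
move=> X_gt0; apply/existsP; exists [set setT]; apply/existsP; exists setT.
apply/andP; split.
  apply/and3P; split.
  - by rewrite /cover big_set1.
  - by apply/trivIsetP => A B /set1P-> /set1P->; rewrite eqxx.
  - by rewrite inE eq_sym -card_gt0 cardsT.
rewrite imset_set1; apply/eqP; congr [set _]; apply/setP => -[x|].
  by rewrite lblock_Some !inE.
by rewrite /lblock !inE orbT.
Qed.

Definition lpart_top (X_gt0 : (0 < #|X|)%N) : lpart :=
  LPart (lpart_top_subproof X_gt0).

End LabelledPartitions.

(* Main.v *)
(* The function that is (-1)^(k-1) (k-1)! on totally labelled partitions with k
   blocks, the opposite on totally unlabelled ones and 0 on all others sums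
   over {pi | sigma <= pi} to [sigma = 1], hence it is pi |-> mu(pi, 1): when
   sigma has no labelled block the two contributions cancel, and otherwise
   only totally labelled pi occur, i.e. the coarsenings of a partition P of X.
   If P has at least two blocks, fix one of them, B.  A coarsening with k blocks
   that contains B yields, by merging B into one of the k-1 other blocks, k-1
   coarsenings with k-1 blocks not containing B, and each such coarsening arises
   exactly once; since (-1)^(k-1) (k-1)! + (k-1) (-1)^(k-2) (k-2)! = 0, the sum
   over all coarsenings vanishes. *)
Require Import Defs.
From HB Require Import structures.
From mathcomp Require Import all_boot all_order all_algebra.

Import Order.TTheory GRing.Theory.

Local Open Scope ring_scope.

Set Implicit Arguments.
Unset Strict Implicit.

(* Although mobius is defined by a recursion on its second argument, it is
   also the inverse of zeta on the other side. *)
Lemma mobius_dual_unique (d : Order.disp_t) (T : finPOrderType d) (t : T)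
    (f : T -> int) :
  (forall x : T, \sum_(z | (x <= z)%O) f z = (x == t)%:R) ->
  forall x, mobius x t = f x.
Proof.
move=> fsum x.
have zeta z : \sum_(y | (y <= z)%O) mobius x y = (x == z)%:R.
  rewrite (bigID (fun y => (x <= y)%O)) /= [X in _ + X]big1 ?addr0; last first.
    by move=> y /andP[_ /mobius_nle].
  under eq_bigl => y do rewrite andbC.
  have [->|xz] := eqVneq x z.
    rewrite (big_pred1 z) ?mobius_refl // => y /=.
    by rewrite -eq_le eq_sym.
  have [lexz|nlexz] := boolP (x <= z)%O.
    by rewrite mobius_sum // lt_neqAle xz.
  apply: big1 => y /andP[xy yz].
  by rewrite (le_trans xy yz) in nlexz.
(* The double sum is evaluated in both orders: summing over [z] first leaves only [y = t], summing
   over [y] first leaves only [z = x]. *)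
transitivity (\sum_y mobius x y * \sum_(z | (y <= z)%O) f z).
  rewrite (bigD1 t) //= fsum eqxx mulr1 big1 ?addr0 // => y /negPf yt.
  by rewrite fsum yt mulr0.
under eq_bigr => y _ do rewrite mulr_sumr.
rewrite (exchange_big_dep predT) //= (bigD1 x) //= -mulr_suml zeta eqxx mul1r.
rewrite big1 ?addr0 // => z /negPf zx.
by rewrite -mulr_suml zeta eq_sym zx mul0r.
Qed.

(** For [k > 0], the Möbius number of the lattice of set partitions of a [k]-element set. *)
Definition part_mobius (k : nat) : int := (-1) ^+ k.-1 * (k.-1)`!%:Z.

(** The recurrence behind the cancellation: the factor [k] will count the blocks that can absorb
    [B]. *)
Lemma part_mobiusS (k : nat) :
  (0 < k)%N -> part_mobius k.+1 = - (part_mobius k *+ k).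
Proof.
case: k => // k _; rewrite /part_mobius /= exprS factS PoszM.
by rewrite mulN1r mulNr mulrCA -mulr_natl natz.
Qed.

(** * Coarsenings of a set partition: merging and splitting blocks *)

Section Coarsenings.
Variables (X : finType) (D : {set X}).
Implicit Types P Q : {set {set X}}.

Definition refines P Q : bool := [forall B in P, exists C in Q, B \subset C].

(** [E] is the block that absorbs [B]; [split_block] goes back by cutting [B] out of the block [C]
    around it ([mergeK], [splitK]). *)
Definition merge (B : {set X}) Q (E : {set X}) : {set {set X}} :=
  (B :|: E) |: (Q :\ B) :\ E.

Definition split_block (B C : {set X}) Q : {set {set X}} :=
  B |: (C :\: B |: Q :\ C).

Lemma partition_disjoint Q B C :
  partition Q D -> B \in Q -> C \in Q -> B != C -> [disjoint B & C].
Proof. by move=> /partition_trivIset/trivIsetP h hB hC; apply: h. Qed.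

Lemma partition_sub_eq Q B C :
  partition Q D -> B \in Q -> C \in Q -> B \subset C -> B = C.
Proof.
move=> pQ hB hC BC; apply/eqP; apply: contraTT isT => nBC.
have := partition_disjoint pQ hB hC nBC.
rewrite -setI_eq0 (setIidPl BC) => /eqP B0.
by have := partition_neq0 pQ hB; rewrite B0 eqxx.
Qed.

Lemma merge_partition B E Q : partition Q D -> B \in Q -> E \in Q :\ B ->
  partition (merge B Q E) D.
Proof.
move=> pQ hB hE; have pB := partitionD1 pQ hB; have pE := partitionD1 pB hE.
have EQ : E \in Q by move: hE; rewrite inE => /andP[].
have sub C : C \in Q -> C \subset D.
  by move=> hC; rewrite -(cover_partition pQ); apply: bigcup_sup.
have -> : D = (B :|: E) :|: (D :\: B :\: E).
  rewrite setDDl; apply/setP => x; rewrite !inE.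
  have := subsetP (sub _ hB) x; have := subsetP (sub _ EQ) x.
  by case: (x \in B) => [_ ->|]; case: (x \in E) => // ->.
apply: partitionU1 => //.
  by rewrite setU_eq0 negb_and (partition_neq0 pQ hB).
by rewrite setDDl -setI_eq0 setIDA setIC -setIDA setDv setI0.
Qed.

(** By [partition_sub_eq] a block containing [B] and [E] would equal both. Hence the union is new,
    and merging loses exactly one block. *)
Lemma merge_notin B E Q : partition Q D -> B \in Q -> E \in Q :\ B ->
  B :|: E \notin Q.
Proof.
move=> pQ hB; rewrite inE => /andP[EB EQ]; apply/negP => hU.
have eB := partition_sub_eq pQ hB hU (subsetUl _ _).
have eE := partition_sub_eq pQ EQ hU (subsetUr _ _).
by move: EB; rewrite inE [E in E == B]eE -eB eqxx.
Qed.

Lemma card_merge B E Q : partition Q D -> B \in Q -> E \in Q :\ B ->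
  #|merge B Q E| = #|Q|.-1.
Proof.
move=> pQ hB hE; rewrite cardsU1 !inE (negPf (merge_notin pQ hB hE)) !andbF.
by rewrite (cardsD1 B Q) hB (cardsD1 E (Q :\ B)) hE.
Qed.

Lemma merge_block_notin B E Q : partition Q D -> B \in Q -> E \in Q :\ B ->
  B \notin merge B Q E.
Proof.
move=> pQ hB hE; rewrite !inE eqxx andbF orbF; apply/negP => /eqP BE.
by have := merge_notin pQ hB hE; rewrite -BE hB.
Qed.

Lemma merge_refines B E P Q : refines P Q -> refines P (merge B Q E).
Proof.
move=> /forall_inP h; apply/forall_inP => A /h/exists_inP[C hC sAC].
apply/exists_inP.
have [eC|nC] := boolP ((C == B) || (C == E)); last first.
  exists C => //; move: nC.
  by rewrite !inE hC negb_or => /andP[-> ->]; rewrite orbT.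
exists (B :|: E); first by rewrite setU11.
by apply: subset_trans sAC _; case/orP: eC => /eqP->; rewrite ?subsetUl ?subsetUr.
Qed.

(** Lets a fixed point [b] of [B] locate the merged block, so that merging can be inverted. *)
Lemma merge_pblock B E Q b : partition Q D -> B \in Q -> E \in Q :\ B ->
  b \in B -> pblock (merge B Q E) b = B :|: E.
Proof.
move=> pQ hB hE bB; apply: def_pblock.
- exact: partition_trivIset (merge_partition pQ hB hE).
- exact: setU11.
- by rewrite inE bB.
Qed.

Lemma setUDl_disjoint (B E : {set X}) : [disjoint B & E] -> (B :|: E) :\: B = E.
Proof. by rewrite disjoint_sym setDUl setDv set0U => /setDidPl. Qed.

Lemma mergeK B E Q : partition Q D -> B \in Q -> E \in Q :\ B ->
  split_block B (B :|: E) (merge B Q E) = Q.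
Proof.
move=> pQ hB hE.
have /andP[nEB EQ] : (E != B) && (E \in Q) by rewrite !inE in hE.
have dBE : [disjoint B & E].
  by apply: partition_disjoint pQ _ _ _; rewrite // eq_sym.
rewrite /split_block setUDl_disjoint // /merge setU1K; last first.
  by rewrite !inE (negPf (merge_notin pQ hB hE)) !andbF.
by rewrite setD1K // setD1K.
Qed.

Lemma setU_setD_id (B C : {set X}) : B \subset C -> B :|: (C :\: B) = C.
Proof. by move/setIidPr => {1}<-; exact: setID. Qed.

Section Split.
Variables (B C : {set X}) (Q : {set {set X}}).
Hypotheses (pQ : partition Q D) (hC : C \in Q) (BC : B \subset C).
Hypotheses (B0 : B != set0) (BQ : B \notin Q).

Let CB0 : C :\: B != set0.
Proof.
rewrite setD_eq0; apply/negP => CB.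
by move: BQ; rewrite (_ : B = C) ?hC //; apply/eqP; rewrite eqEsubset BC CB.
Qed.

Let disj (A : {set X}) : A \subset C -> [disjoint A & D :\: C].
Proof.
move=> sAC; apply: disjointWl sAC _.
by rewrite -setI_eq0 setIDA setIC -setIDA setDv setI0.
Qed.

Let pC : partition (C :\: B |: Q :\ C) (C :\: B :|: D :\: C).
Proof. by apply: partitionU1 (partitionD1 pQ hC) CB0 (disj (subsetDl _ _)). Qed.

Lemma split_partition : partition (split_block B C Q) D.
Proof.
have CD : C \subset D by rewrite -(cover_partition pQ); apply: bigcup_sup.
have -> : D = B :|: (C :\: B :|: D :\: C).
  by rewrite setUA !setU_setD_id.
apply: partitionU1 => //; rewrite -setI_eq0 setIUr setU_eq0.
rewrite !setI_eq0 disj // andbT disjoint_sym -setI_eq0.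
by rewrite setIC setIDA setIC -setIDA setDv setI0.
Qed.

Lemma split_mem : C :\: B \in split_block B C Q :\ B.
Proof.
rewrite !inE eqxx !orbT andbT; have /set0Pn[x xB] := B0.
by apply/negP => /eqP/setP/(_ x); rewrite inE xB.
Qed.

Lemma splitK : merge B (split_block B C Q) (C :\: B) = Q.
Proof.
(* Applied to [B] and to [C :\: B]: neither is already among the other blocks, so deleting them
   exactly undoes adding them. *)
have h (A : {set X}) : A \subset C -> A != set0 -> A \notin Q :\ C.
  move=> sAC A0; rewrite !inE; apply/negP => /andP[nAC AQ].
  by rewrite (partition_sub_eq pQ AQ hC sAC) eqxx in nAC.
rewrite /merge /split_block setU1K; last first.
  rewrite inE (negPf (h _ BC B0)) orbF inE; apply/negP => /eqP e.
  by have := split_mem; rewrite -e !inE eqxx.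
rewrite setU1K ?h ?subsetDl //.
have -> : B :|: C :\: B = C by exact: setU_setD_id.
by rewrite setD1K.
Qed.

Lemma split_refines P : partition P D -> B \in P -> refines P Q ->
  refines P (split_block B C Q).
Proof.
move=> pP hB /forall_inP h; apply/forall_inP => A hA.
apply/exists_inP; have [eA|nAB] := eqVneq A B.
  by exists B; rewrite ?setU11 // eA.
have /exists_inP[C' hC' AC'] := h _ hA.
have [eC|nC] := eqVneq C' C; last first.
  by exists C' => //; rewrite !inE nC hC' !orbT.
exists (C :\: B); first by rewrite !inE eqxx orbT.
(* Being disjoint from [B], a block [A] inside [C] survives the cut. *)
by rewrite subsetD -eC AC' (partition_disjoint pP).
Qed.

End Split.

(** * Cancellation over all coarsenings of a partition *)

Lemma sum_coarsening_part_mobius P : partition P D -> (1 < #|P|)%N ->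
  \sum_(Q | partition Q D && refines P Q) part_mobius #|Q| = 0.
Proof.
move=> pP P1; have /card_gt0P[B hB] : (0 < #|P|)%N by apply: ltnW.
have B0 := partition_neq0 pP hB; have /set0Pn[b bB] := B0.
have blockP Q : partition Q D -> refines P Q ->
    (pblock Q b \in Q) /\ (B \subset pblock Q b).
  move=> pQ /forall_inP/(_ _ hB)/exists_inP[C hC BC].
  by rewrite (def_pblock (partition_trivIset pQ) hC) // (subsetP BC).
rewrite (bigID (fun Q => B \in Q)) /=.
(* Coarsenings without the block [B] are reindexed by pairs [(Q, E)] with [B] and [E] distinct
   blocks of [Q]. The inverse [h'] cuts [B] out of the block through [b] and keeps the remainder as
   [E]. *)
pose h' Q := (split_block B (pblock Q b) Q, pblock Q b :\: B).
rewrite [X in _ + X](reindex_onto (fun j => merge B j.1 j.2) h') /=; last first.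
  move=> Q /andP[/andP[pQ PQ] BQ].
  by have [hC BC] := blockP Q pQ PQ; apply: splitK.
rewrite (eq_bigl (fun j => [&& partition j.1 D, refines P j.1 & B \in j.1]
    && (j.2 \in j.1 :\ B))); last first.
  case=> Q E /=; apply/idP/idP.
    move: (merge B Q E) => M /andP[/andP[/andP[pM PM] BM]].
    have [hC BC] := blockP _ pM PM => /eqP[<- <-].
    rewrite split_partition // split_mem // split_refines //.
    by rewrite setU11.
  move=> /andP[/and3P[pQ PQ BQ] hE].
  rewrite merge_partition // merge_refines // merge_block_notin //=.
  rewrite /h' merge_pblock // mergeK //; move: hE; rewrite !inE => /andP[nE EQ].
  rewrite setUDl_disjoint ?eqxx //.
  by apply: partition_disjoint pQ _ _ _; rewrite // eq_sym.
rewrite -(pair_big_dep (fun Q => [&& partition Q D, refines P Q & B \in Q])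
  (fun Q E => E \in Q :\ B) (fun Q E => part_mobius #|merge B Q E|)) /=.
rewrite [X in _ + X](eq_bigl (fun Q => (partition Q D && refines P Q) && (B \in Q))); last first.
  by move=> Q; rewrite andbA.
rewrite -big_split /= big1 // => Q /andP[/andP[pQ PQ] BQ].
rewrite (eq_bigr (fun=> part_mobius #|Q|.-1)); last first.
  by move=> E hE; rewrite card_merge.
have cQ : #|Q| = #|Q :\ B|.+1 by rewrite (cardsD1 B Q) BQ.
rewrite sumr_const cQ /= part_mobiusS ?addNr // card_gt0.
(* The recurrence requires a block of [Q] other than [B]. If there were none, every block of [P]
   would lie in [B], hence equal it, and [P] would have only one block. *)
apply/negP => /eqP Q0.
have QB : Q = [set B] by rewrite -(setD1K BQ) Q0 setU0.
have PB A : A \in P -> A = B.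
  move: PQ => /forall_inP h /[dup] hA /h/exists_inP[C].
  by rewrite QB inE => /eqP-> AB; apply: partition_sub_eq pP _ _ AB.
have : P \subset [set B] by apply/subsetP => A /PB ->; rewrite inE.
by move/subset_leq_card; rewrite cards1 leqNgt P1.
Qed.

End Coarsenings.

Lemma sum_coarsening (X : finType) (P : {set {set X}}) :
  (0 < #|X|)%N -> partition P [set: X] ->
  \sum_(Q | partition Q [set: X] && refines P Q) part_mobius #|Q| =
  (P == [set [set: X]])%:R.
Proof.
move=> X_gt0 pP; have [P1|P1] := ltnP 1 #|P|.
  rewrite sum_coarsening_part_mobius //; case: eqP => // eP.
  by rewrite eP cards1 in P1.
have P0 : P != set0.
  apply/eqP => eP; have /card_gt0P[x _] := X_gt0.
  by have := in_setT x; rewrite -(cover_partition pP) eP /cover big_set0 inE.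
have eP : P = [set [set: X]].
  have /cards1P[A eA] : #|P| == 1%N by rewrite eqn_leq P1 card_gt0.
  by rewrite -(cover_partition pP) eA /cover big_set1.
(* The one-block partition has no coarsening but itself, and [part_mobius 1] is 1. *)
rewrite (big_pred1 P) => [|Q]; first by rewrite eP eqxx cards1.
apply/andP/eqP => [[pQ]|->]; last first.
  by split=> //; apply/forall_inP => B hB; apply/exists_inP; exists B.
move/forall_inP/(_ setT); rewrite eP set11 => /(_ isT)/exists_inP[C hC].
rewrite subTset => /eqP eC; apply/setP => A; rewrite inE.
apply/idP/eqP => [hA|->]; last by rewrite -eC.
by apply: partition_sub_eq pQ _ _ _; rewrite // -?eC // eC subsetT.
Qed.

(** * Labelled blocks, and partitions with all or no blocks labelled *)

Section LabelledBlocks.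
Variable X : finType.
Implicit Types (P Q L : {set {set X}}) (B C : {set X}).

Lemma lblock_None L B : (None \in lblock L B) = (B \in L).
Proof.
rewrite inE; case: ifP; rewrite !inE ?orbT // orbF => _.
by apply/negbTE/negP => /imsetP[].
Qed.

Lemma lblock_sub L L' B C :
  (lblock L B \subset lblock L' C) = (B \subset C) && ((B \in L) ==> (C \in L')).
Proof.
apply/subsetP/andP => [h|[/subsetP BC /implyP BL] [x|]].
- split; last by apply/implyP; rewrite -!lblock_None; apply: h.
  by apply/subsetP => x; rewrite -(lblock_Some L) -(lblock_Some L' C); apply: h.
- by rewrite !lblock_Some; apply: BC.
- by rewrite !lblock_None.
Qed.

(** Taking preimages under [Some] forgets the labels and recovers the underlying partition. *)
Lemma lblock_imset_inj L L' P Q :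
  lblock L @: P = lblock L' @: Q -> P = Q.
Proof.
have lblockK K B : Some @^-1: lblock K B = B.
  by apply/setP => x; rewrite inE lblock_Some.
have unlabel K (R : {set {set X}}) :
    [set Some @^-1: (A : {set option X}) | A in lblock K @: R] = R.
  by rewrite -imset_comp (eq_imset (g := id)) ?imset_id // => B; apply: lblockK.
by move=> e; rewrite -[P](unlabel L) e unlabel.
Qed.

Definition uniform_lblock (b : bool) : {set X} -> {set option X} :=
  lblock (if b then setT else set0).

Lemma uniform_lblock_eq a b P Q : P != set0 ->
  (uniform_lblock a @: P == uniform_lblock b @: Q) = (P == Q) && (a == b).
Proof.
move=> /set0Pn[B hB]; apply/eqP/andP => [h|[/eqP-> /eqP->] //].
rewrite (lblock_imset_inj h); split=> //.
(* A single block suffices to read off the common label; this is where [P != set0] enters. *)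
have /imsetP[C _ /setP/(_ None)] : uniform_lblock a B \in uniform_lblock b @: Q.
  by rewrite -h imset_f.
by rewrite !lblock_None; case: a b {h} => -[]; rewrite !inE.
Qed.

Lemma uniform_is_lpart b Q :
  partition Q [set: X] -> is_lpart (uniform_lblock b @: Q).
Proof.
move=> pQ; apply/existsP; exists Q; apply/existsP.
by exists (if b then setT else set0); rewrite pQ eqxx.
Qed.

(** A labelled block fits only into a labelled one: an all-labelled [pi] adds no constraint to
    refinement, an unlabelled one forbids labels in [sigma]. *)
Lemma le_uniform (sigma pi : lpart X) b L P Q :
  lblock L @: P = sigma -> uniform_lblock b @: Q = pi ->
  (sigma <= pi)%O = refines P Q && (b || [disjoint P & L]).
Proof.
move=> eP eQ.
have -> : (sigma <= pi)%O = lpart_le sigma pi by [].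
apply/forall_inP/andP => [h|[/forall_inP h bPL] A].
  have h' B : B \in P ->
      exists2 C, C \in Q & (B \subset C) && ((B \in L) ==> b).
    move=> hB.
    have /exists_inP[A] : [exists C in lpart_blocks pi, lblock L B \subset C].
      by apply: h; rewrite -eP imset_f.
    rewrite -eQ => /imsetP[C hC ->]; rewrite lblock_sub => hBC; exists C => //.
    by move: hBC; case: (b); rewrite !inE.
  split.
    by apply/forall_inP => B /h'[C hC /andP[? _]]; apply/exists_inP; exists C.
  case: b {eQ h} h' => //= h'.
  rewrite disjoint_subset; apply/subsetP => B /h'[C _].
  by rewrite implybF => /andP[].
rewrite -eP => /imsetP[B hB ->]; have /exists_inP[C hC BC] := h B hB.
apply/exists_inP; exists (uniform_lblock b C); first by rewrite -eQ imset_f.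
rewrite lblock_sub BC /=; case: b bPL {eQ} => /=; first by rewrite inE implybT.
by move=> /disjointFr-> //.
Qed.

(** * The Möbius function into the top element *)

(** At most one [Q] matches [pi], by [lblock_imset_inj]. Summing over all candidates avoids
    extracting the underlying partition and prepares an exchange of sums. *)
Definition lpart_mobius (pi : lpart X) : int :=
  \sum_(Q | partition Q [set: X]) part_mobius #|Q| *
    ((lpart_blocks pi == uniform_lblock true @: Q)%:R
     - (lpart_blocks pi == uniform_lblock false @: Q)%:R).

Lemma lpart_mobius_uniform b P (pi : lpart X) :
  partition P [set: X] -> P != set0 -> uniform_lblock b @: P = pi ->
  lpart_mobius pi = (if b then part_mobius #|P| else - part_mobius #|P|).
Proof.
move=> pP P0 e; rewrite /lpart_mobius (bigD1 P) //= -e !uniform_lblock_eq // eqxx.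
rewrite big1 ?addr0 => [|Q /andP[_ /negPf nQ]].
  by case: b {e}; rewrite /= ?subr0 ?sub0r ?mulrN mulr1.
by rewrite !uniform_lblock_eq // eq_sym nQ subrr mulr0.
Qed.

Lemma sum_lpart_mobius (X_gt0 : (0 < #|X|)%N) (sigma : lpart X) :
  \sum_(pi | (sigma <= pi)%O) lpart_mobius pi = (sigma == lpart_top X_gt0)%:R.
Proof.
have [P [L [pP eP]]] :
    exists P L, partition P [set: X] /\ lblock L @: P = sigma.
  case: sigma => s /= /existsP[P /existsP[L /andP[pP /eqP->]]].
  by exists P, L.
have count b Q : partition Q [set: X] ->
    \sum_(pi : lpart X | (sigma <= pi)%O)
      (lpart_blocks pi == uniform_lblock b @: Q)%:R
    = (refines P Q && (b || [disjoint P & L]))%:R :> int.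
  move=> pQ; pose q := LPart (uniform_is_lpart b pQ).
  rewrite -(le_uniform (pi := q) eP) //.
  have qE pi : (lpart_blocks pi == uniform_lblock b @: Q) = (pi == q).
    by rewrite -(val_eqE pi).
  under eq_bigr => pi _ do rewrite qE.
  have [leq|nleq] := boolP (sigma <= q)%O.
    rewrite (bigD1 q) //= eqxx big1 ?addr0 // => pi /andP[_ /negPf->] //.
  by apply: big1 => pi lepi; case: eqP => // epi; rewrite -epi lepi in nleq.
have topE : uniform_lblock true @: [set setT] = lpart_top X_gt0.
  rewrite imset_set1; congr [set _]; apply/setP => -[x|].
    by rewrite lblock_Some !inE.
  by rewrite lblock_None !inE.
rewrite exchange_big /=.
(* For each [Q] coarser than [P] the labelled copy always lies above [sigma], the unlabelled one
   only if [sigma] has no label; the difference is the indicator that some block of [sigma] is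
   labelled. *)
transitivity (\sum_(Q | partition Q [set: X] && refines P Q) part_mobius #|Q|
    * (~~ [disjoint P & L])%:R).
  rewrite [RHS]big_mkcondr; apply: eq_bigr => Q pQ.
  rewrite -mulr_sumr sumrB !count //=.
  case: (refines P Q); rewrite /= ?subrr ?mulr0 //.
  by case: [disjoint P & L]; rewrite /= ?subrr ?subr0.
(* What remains is that [sigma] is the top exactly when [P] is the one-block partition and carries a
   label. *)
rewrite -mulr_suml sum_coarsening // -natrM mulnb; congr (_ : bool)%:R.
rewrite -(val_eqE sigma) -[val sigma]eP /=; have [->|nP] := eqVneq P [set setT].
  rewrite disjoints1 negbK imset_set1 (inj_eq set1_inj).
  apply/idP/eqP => [TL|/setP/(_ None)]; last by rewrite lblock_None inE.
  by apply/setP => -[x|]; rewrite ?lblock_Some ?lblock_None !inE.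
apply/esym/negbTE; apply: contraNneq nP => e; apply/eqP.
by apply: (lblock_imset_inj (L := L) (L' := setT)); rewrite e -[LHS]topE.
Qed.

End LabelledBlocks.

Theorem theorem4p10 (X : finType) (n : nat)
    (X_gt0 : (0 < #|X|)%N) (cardX : #|X| = n) :
  mobius (lpart_sing X) (lpart_top X_gt0) = (-1) ^+ n.-1 * (n.-1)`!%:Z /\
  mobius (lpart_bot X) (lpart_top X_gt0) = (-1) ^+ n * (n.-1)`!%:Z.
Proof.
rewrite !(mobius_dual_unique (sum_lpart_mobius X_gt0)).
have pS := partition_singletons X; set S := [set _ | _ in _] in pS.
have cS : #|S| = n by rewrite card_imset //; apply: set1_inj.
have S0 : S != set0 by rewrite -card_gt0 cS -cardX.
rewrite (lpart_mobius_uniform (b := true) pS S0); last first.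
  rewrite -imset_comp; apply: eq_imset => x.
  by rewrite /= /uniform_lblock /lblock inE imset_set1.
rewrite (lpart_mobius_uniform (b := false) pS S0); last first.
  rewrite -imset_comp; apply: eq_imset => x.
  by rewrite /= /uniform_lblock /lblock inE imset_set1 setU0.
rewrite cS; split=> //; rewrite /part_mobius -mulNr.
(* Since [n > 0], the sign of the unlabelled case is one more factor -1. *)
by rewrite -[in RHS](prednK (n := n)) -?cardX // exprS mulN1r.
Qed.
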